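(* Let $a\in\mathbb{R}$ and $n\in\{0,1,2,\dots\}$. Then the $n$ zeros (in $\mathbb{C}$, counted with multiplicity) of the polynomial $K_n(x;p,a)$ in the variable $x$ approach the points $x=0,1,\dots,n-1$ as $p\to 0$ ($p$ real, $p\neq 0$).
   Context: The Pochhammer symbol is $(\alpha)_0=1$ and $(\alpha)_m=\alpha(\alpha+1)\cdots(\alpha+m-1)$ for $m\ge 1$. For $n\in\{0,1,2,\dots\}$, $a\in\mathbb{R}$ and real $p\neq 0$, the polynomial $K_n(x;p,a)$ of degree $n$ in $x$ is given by $$K_n(x;p,a)=\sum_{k=0}^n\frac{(-n)_k(-x)_k(-a+k)_{n-k}}{k!\,p^k}.$$ That the zeros approach $0,1,\dots,n-1$ means that, for each $p$, the $n$ zeros can be labelled $x_0(p),\dots,x_{n-1}(p)$ so that $x_j(p)\to j$ as $p\to 0$ for each $j=0,\dots,n-1$. *)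

(* Defs.v *)
From HB Require Import structures.
From mathcomp Require Import all_boot all_order all_algebra.
From mathcomp Require Import all_classical all_reals all_analysis.
From mathcomp Require Import complex.

Set Implicit Arguments.
Unset Strict Implicit.
Unset Printing Implicit Defensive.

Import Order.TTheory GRing.Theory Num.Theory numFieldNormedType.Exports.
Local Open Scope ring_scope.

(* The base may be a scalar or a polynomial: both kinds occur in K below. *)
Definition pochhammer (A : comNzRingType) (x : A) (m : nat) : A :=
  \prod_(i < m) (x + i%:R).

(* A polynomial in the variable 'X; the definition is total, but it is
   meaningful only for p != 0. *)
Definition K (R : realType) (n : nat) (p a : R) : {poly R} :=
  \sum_(k < n.+1)
    ((pochhammer (- n%:R) k * pochhammer (- a + k%:R) (n - k))
       / (k`!%:R * p ^+ k)) *: pochhammer (- 'X) k.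

(* The family x lists all the zeros of q, each as often as its multiplicity;
   in particular q has exactly n zeros counted with multiplicity. *)
Definition labels_zeros (C : fieldType) (n : nat) (q : {poly C})
    (x : 'I_n -> C) : Prop :=
  q != 0 /\ forall z : C, #|[set j | x j == z]%SET| = mup z q.

(* Main.v *)
Require Import Defs.
From HB Require Import structures.
From mathcomp Require Import all_boot all_order all_algebra.
From mathcomp Require Import all_fingroup.
From mathcomp Require Import all_classical all_reals all_analysis.
From mathcomp Require Import complex.
From mathcomp Require Import ring.
Import Order.TTheory GRing.Theory Num.Theory numFieldNormedType.Exports.
Local Open Scope ring_scope.
Local Open Scope classical_set_scope.

(** In K, the variable p occurs only through the factors p^-k, k <= n, and the
    top term carries p^-n. Since
    (-n)_n (-x)_n = n! x (x - 1) ... (x - n + 1), the polynomial p^n K is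
    monic of degree n in x ([size_lead_coef_K]), and it tends to
    x (x - 1) ... (x - n + 1) as p -> 0. In particular p^n K(j) -> 0 for every
    j < n ([cvg_expM_K]).

    This smallness passes to the zeros because the limit points 0, ..., n-1
    are distinct and as many as the zeros. Write p^n K as the product of the x - z_i over the complex
    zeros z_i. If |p^n K(j)| < e^n, then one of the n factors |j - z_i| is
    below e. When this holds for every j with some e <= 1/2, a zero cannot be within e of two different
    integers, so that choosing a nearest zero for each j is injective, hence
    a relabelling of all the zeros with their multiplicities
    ([matching_small_products]). The nearest zero does not depend on e, so
    for each p one relabelling serves all e simultaneously: this gives a
    function of p for which the limits can be taken. *)

(** Sending j to the index of a z_i nearest to c_j does not involve e, and this
    is why a single s works for all e. If no e satisfies the hypothesis this
    map may fail to be injective, but then any s will do. *)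
Lemma matching_small_products (C : numDomainType) (n : nat) (d : C)
    (c z : 'I_n -> C) :
    (forall i j, i != j -> d + d <= `|c i - c j|) ->
  exists s : {perm 'I_n}, forall e : C, 0 <= e <= d ->
    (forall j, `|\prod_i (c j - z i)| < e ^+ n) ->
    forall j, `|c j - z (s j)| < e.
Proof.
move=> sep.
pose f j := [arg min_(i < j) `|c j - z i|]%O.
have fmin j i : `|c j - z (f j)| <= `|c j - z i|.
  rewrite /f; case: real_arg_minP => [//|k _|k _ fk]; first exact: normr_real.
  exact: fk.
have fnear e : 0 <= e -> (forall j, `|\prod_i (c j - z i)| < e ^+ n) ->
    forall j, `|c j - z (f j)| < e.
  move=> e0 small j; rewrite real_ltNge ?ger0_real//.
  apply/negP => le_e; have := small j.
  rewrite normr_prod real_ltNge ?ger0_real ?exprn_ge0 ?prodr_ge0//.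
  move=> /negP; apply.
  rewrite -[X in e ^+ X]card_ord -prodr_const.
  by apply: ler_prod => i _; rewrite e0 (le_trans le_e).
(* The bound just proved makes f injective as soon as one admissible e
   exists; the identity is a dummy value for the remaining case. *)
have [/injectiveP injf|ninjf] := boolP (injectiveb f).
  by exists (perm injf) => e /andP[e0 _] small j; rewrite permE; apply: fnear.
exists 1%g => e /andP[e0 ed] small j; case/negP: ninjf.
apply/injectiveP => i k eqf; apply/eqP; apply: contraT => /sep.
rewrite real_leNgt ?ger0_real ?addr_ge0 ?(le_trans e0 ed)// => /negP[].
apply: lt_le_trans (lerD ed ed).
rewrite -(subrKA (z (f i))) (le_lt_trans (ler_normD _ _))//.
by rewrite ltrD ?fnear// eqf distrC fnear.
Qed.

Lemma labels_zeros_scale_prod (F : fieldType) (n : nat) (c : F)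
    (z : 'I_n -> F) : c != 0 ->
  labels_zeros (c *: \prod_i ('X - (z i)%:P)) z.
Proof.
move=> c0; have q0 : \prod_i ('X - (z i)%:P) != 0 :> {poly F}.
  by apply/prodf_neq0 => i _; rewrite polyXsubC_eq0.
split=> [|w]; first by rewrite scaler_eq0 negb_or c0.
rewrite -mul_polyC mupMr ?rootC//.
rewrite -(big_map z xpredT (fun y => 'X - y%:P)) mu_prod_XsubC.
rewrite count_map cardsE cardE /enum_mem size_filter /=.
by rewrite [index_enum _]unlock.
Qed.

Lemma pochhammerN (A : comNzRingType) (x : A) (m : nat) :
  pochhammer (- x) m = (-1) ^+ m * \prod_(i < m) (x - i%:R).
Proof.
rewrite /pochhammer -[X in _ ^+ X]card_ord -prodrN.
by apply: eq_bigr => i _; rewrite opprB addrC.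
Qed.

(** For j < m both sides vanish: the factor of index j on the left is zero, and
    so is the falling factorial. For j = m the value is (-1)^m m!. *)
Lemma pochhammerN_natr (A : comNzRingType) (j m : nat) :
  pochhammer (- j%:R : A) m = (-1) ^+ m * (j ^_ m)%:R.
Proof.
rewrite pochhammerN; have [jm|mj] := ltnP j m.
  rewrite ffact_small// mulr0 (bigD1 (Ordinal jm))//= subrr mul0r.
  by rewrite mulr0.
rewrite ffact_prod natr_prod; congr (_ * _); apply: eq_bigr => i _.
by rewrite natrB// (leq_trans (ltnW (ltn_ord i))).
Qed.

Lemma pochhammerNX_factor (A : comNzRingType) (m : nat) :
  pochhammer (- 'X : {poly A}) m =
  (-1) ^+ m *: \prod_(i < m) ('X - (i%:R)%:P).
Proof.
rewrite pochhammerN -mul_polyC rmorph_sign.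
by congr (_ * _); apply: eq_bigr => i _; rewrite polyC_natr.
Qed.

Lemma size_pochhammerNX (A : idomainType) (m : nat) :
  size (pochhammer (- 'X : {poly A}) m) = m.+1.
Proof.
rewrite pochhammerNX_factor size_scale ?signr_eq0//.
by rewrite size_prod_XsubC [index_enum _]unlock -enumT size_enum_ord.
Qed.

Lemma horner_pochhammerNX (A : comNzRingType) (m : nat) (x : A) :
  (pochhammer (- 'X) m).[x] = pochhammer (- x) m.
Proof.
rewrite /pochhammer horner_prod; apply: eq_bigr => i _.
by rewrite !hornerE -polyC_natr hornerC.
Qed.

(** Only the term k = n reaches degree n. Its coefficient is
    (-n)_n / (n! p^n) = (-1)^n / p^n, and the sign cancels the leading
    coefficient (-1)^n of (-x)_n. *)
Lemma size_lead_coef_K (R : realType) (n : nat) (p a : R) : p != 0 ->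
  size (K n p a) = n.+1 /\ lead_coef (K n p a) = p ^- n.
Proof.
move=> p0; rewrite /K big_ord_recr/= subnn.
rewrite [pochhammer _ 0]big_ord0 mulr1 pochhammerN_natr ffactnn.
set c := _ / _; set S := \sum_(_ < _) _.
have cE : c * (-1) ^+ n = p ^- n.
  by rewrite /c mulrC !mulrA -expr2 sqrr_sign mul1r invfM mulrA divff ?mul1r//.
have c0 : c != 0.
  apply: contra_eq_neq cE => ->; rewrite mul0r eq_sym invr_neq0//.
  by rewrite expf_neq0.
have sT : size (c *: pochhammer (- 'X) n) = n.+1.
  by rewrite size_scale// size_pochhammerNX.
have ltST : (size S < size (c *: pochhammer (- 'X) n)%R)%N.
  rewrite sT ltnS (leq_trans (size_sum _ _ _))//; apply/bigmax_leqP => k _.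
  by rewrite (leq_trans (size_scale_leq _ _))// size_pochhammerNX.
rewrite addrC size_polyDl// lead_coefDl// sT; split=> //.
rewrite lead_coefZ pochhammerNX_factor lead_coefZ.
by rewrite (monicP (monic_prod_XsubC _ _ _)) mulr1.
Qed.

(** At x = j < n the term k = n of K vanishes, and every other term of
    p^n K(j) carries a positive power p^(n-k). So p^n K(j) agrees for p != 0
    with a polynomial in p without constant term. *)
Lemma cvg_expM_K (R : realType) (n j : nat) (a : R) : (j < n)%N ->
  p ^+ n * (K n p a).[j%:R] @[p --> (0 : R)^'] --> (0 : R).
Proof.
move=> jn.
pose b (k : 'I_n) : R :=
  pochhammer (- n%:R) k * pochhammer (- a + k%:R) (n - k) / k`!%:R
  * pochhammer (- j%:R) k.
pose Q : {poly R} := \sum_(k < n) b k *: 'X^(n - k).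
have Q0 : Q.[0] = 0.
  rewrite horner_sum big1// => k _.
  by rewrite !hornerE expr0n subn_eq0 leqNgt ltn_ord mulr0.
have QE p : p != 0 -> Q.[p] = p ^+ n * (K n p a).[j%:R].
  move=> p0; rewrite /K big_ord_recr/= hornerD !horner_sum.
  rewrite hornerZ horner_pochhammerNX (pochhammerN_natr _ j n) ffact_small//.
  rewrite !mulr0 addr0 mulr_sumr; apply: eq_bigr => k _.
  rewrite !hornerZ hornerXn horner_pochhammerNX /b exprB ?unitfE// 1?ltnW//.
  by rewrite invfM; ring.
rewrite -[X in _ --> X]Q0.
apply: cvg_trans (near_eq_cvg _) _; last first.
  apply/continuous_withinNx; exact: continuous_horner.
by near do apply: QE; exact: nbhs_dnbhs_neq.
Unshelve. all: by end_near. Qed.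

Lemma natr_dist_ge1 (C : numDomainType) (i k : nat) :
  i != k -> 1 <= `|i%:R - k%:R : C|.
Proof.
wlog ik : i k / (i < k)%N => [main|_].
  by case: ltngtP => // [ik|ki] _; [|rewrite distrC]; apply: main;
    rewrite // neq_ltn ?ik ?ki.
by rewrite distrC -natrB ?(ltnW ik)// normr_nat ler1n subn_gt0.
Qed.

Lemma norm_real_complex (R : rcfType) (x : R) :
  `|real_complex R x| = real_complex R `|x|.
Proof. by rewrite normc_def/= expr0n addr0 sqrtr_sqr. Qed.

Theorem theorem12 (R : realType) (a : R) (n : nat) :
  exists x : R -> 'I_n -> R[i],
    (forall p : R, p != 0 ->
       labels_zeros (map_poly (real_complex R) (K n p a)) (x p)) /\
    (forall j : 'I_n, x p j @[p --> (0 : R)^'] --> ((j : nat)%:R : R[i]^o)).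
Proof.
(* Distinct integers are at least 2 * (1 / 2) apart. *)
pose d : R := 1 / 2.
(* The second clause is uniform in e, so that a labelling can be chosen for
   each p before any limit is considered. *)
pose good (p : R) (x : 'I_n -> R[i]) :=
  labels_zeros (map_poly (real_complex R) (K n p a)) x /\
  forall e : R, 0 <= e <= d ->
    (forall j : 'I_n, `|p ^+ n * (K n p a).[(j : nat)%:R]| < e ^+ n) ->
    forall j : 'I_n, `|(j : nat)%:R - x j| < (e%:C)%C.
have ex_good p : exists x, p != 0 -> good p x.
  have [->|p0] := eqVneq p 0; first by exists (fun=> 0).
  have [szK lcK] := size_lead_coef_K _ n _ a p0.
  have [r Kr] := closed_field_poly_normal (map_poly (real_complex R) (K n p a)).
  have szr : size r = n.
    have := congr1 (fun q : {poly _} => size q) Kr.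
    rewrite size_map_poly szK lead_coef_map lcK size_scale; last first.
      by rewrite fmorph_eq0 invr_neq0// expf_neq0.
    by rewrite size_prod_XsubC => -[].
  pose z (i : 'I_n) := r`_i.
  have Kz : map_poly (real_complex R) (K n p a) =
      real_complex R (p ^- n) *: \prod_i ('X - (z i)%:P).
    by rewrite {1}Kr lead_coef_map lcK (big_nth 0) szr big_mkord.
  have sep (i k : 'I_n) : i != k ->
      (d%:C + d%:C)%C <= `|(i : nat)%:R - (k : nat)%:R : R[i]|.
    rewrite -rmorphD /d -splitr; exact: natr_dist_ge1.
  have [s near_s] := matching_small_products _ _ _ _ z sep.
  exists (z \o s) => _; split=> [|e /andP[e0 ed] small].
    rewrite Kz (reindex_inj (@perm_inj _ s))/=.
    apply: labels_zeros_scale_prod.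
    by rewrite fmorph_eq0 invr_neq0// expf_neq0.
  apply: near_s => [|j]; first by rewrite !lecR e0.
  have := small j.
  have -> : \prod_i ((j : nat)%:R - z i) =
      real_complex R (p ^+ n * (K n p a).[(j : nat)%:R]).
    rewrite rmorphM/= -horner_map/= rmorph_nat Kz hornerZ horner_prod mulrA.
    rewrite -rmorphM/= divff ?expf_neq0// rmorph1 mul1r.
    by apply: eq_bigr => i _; rewrite hornerXsubC.
  by rewrite norm_real_complex -rmorphXn ltcR.
have [x xgood] := choice ex_good.
exists x; split=> [p p0|j]; first exact: (xgood p p0).1.
apply/(@cvgrPdist_lt _ (R[i]^o)) => eps eps0.
have [e [e0 ed eeps]] : exists e : R, [/\ 0 < e, e <= d & (e%:C)%C <= eps].
  move: eps0; rewrite ltcE/= => /andP[/eqP im0 re0].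
  exists (Num.min (complex.Re eps) d); split.
  - by rewrite lt_min re0 divr_gt0.
  - by rewrite ge_min lexx orbT.
  - by rewrite lecE/= im0 eqxx ge_min lexx.
near=> p.
have p0 : p != 0 by near: p; exact: nbhs_dnbhs_neq.
apply: lt_le_trans eeps; apply: (xgood p p0).2; first by rewrite ltW.
near: p; apply: filter_forall => i.
apply: cvgr0_norm_lt; first exact: cvg_expM_K.
by rewrite exprn_gt0.
Unshelve. all: by end_near. Qed.
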